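(* Let $S$ be a numerical semigroup, let $b\in S$ be an odd integer, and let $E$ be a relative ideal of $S$ such that $E+E+b\subseteq S$ and $2f(S)>2f(E)+b$. Then the numerical duplication $T:=S\bowtie^b E$ is almost symmetric (with even type) if and only if the following properties hold: (i) $S$ is almost symmetric; (ii) $M(S)-E\subseteq (E-M(S))+b$; (iii) $K(S)\subseteq E-E$.
   Context: $\mathbb{N}$ denotes the non-negative integers. A numerical semigroup $S$ is a submonoid of $\mathbb{N}$ with $\mathbb{N}\setminus S$ finite; $f(S)=\max(\mathbb{Z}\setminus S)$ is its Frobenius number (so $f(\mathbb{N})=-1$). $\mathrm{PF}(S)=\{x\in\mathbb{Z}\setminus S \mid x+s\in S \text{ for any } s\in S\setminus\{0\}\}$, and the type of $S$ is $|\mathrm{PF}(S)|$. $\mathrm{L}(S)=\{x\in\mathbb{Z} \mid x\notin S,\ f(S)-x\notin S\}$; $S$ is almost symmetric if $\mathrm{L}(S)\subseteq \mathrm{PF}(S)$. A relative ideal of $S$ is a nonempty $E\subseteq\mathbb{Z}$ with $E+S\subseteq E$ and $x+E\subseteq S$ for some $x\in S$; $f(E)=\max(\mathbb{Z}\setminus E)$. $M(S)=S\setminus\{0\}$ and $K(S)=\{x\in\mathbb{Z}\mid f(S)-x\notin S\}$ are relative ideals of $S$. For relative ideals $E,F$ of $S$, $E-F=\{x\in\mathbb{Z}\mid x+y\in E\text{ for any }y\in F\}$; for an integer $z$, $E+z$ denotes the translate. For $b\in S$ odd and $E$ a relative ideal with $E+E+b\subseteq S$, the numerical duplication is the numerical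 semigroup $S\bowtie^b E=2\cdot S\cup(2\cdot E+b)$, where $2\cdot X=\{2x\mid x\in X\}$. *)

(* Defs.v *)
From mathcomp Require Import all_boot all_order all_algebra finmap.
From mathcomp Require Import zify.
From mathcomp Require Import boolp classical_sets functions cardinality.

Set Implicit Arguments.
Unset Strict Implicit.
Unset Printing Implicit Defensive.

Import Order.TTheory GRing.Theory Num.Theory.

Local Open Scope classical_set_scope.
Local Open Scope ring_scope.

(* Numerical semigroups are viewed as subsets of Z, so that they live in the
   same type as their relative ideals. *)
Record numerical_semigroup (S : set int) : Prop := NumericalSemigroup {
  numsg_ge0 : S `<=` [set x | 0 <= x];
  numsg0 : S 0;
  numsgD : [set x + y | x in S & y in S] `<=` S;
  numsg_cofinite : finite_set ([set x | 0 <= x] `\` S)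
}.

(* The maximum of Z \ X. The default value 0 is only taken when this maximum
   does not exist, which happens neither for numerical semigroups nor for
   relative ideals: see numsg_frobeniusP and rel_ideal_frobeniusP. *)
Definition frobenius (X : set int) : int :=
  xget 0 [set m | (~` X) m /\ ubound (~` X) m].

Definition max_ideal (S : set int) : set int := S `\ 0.

Definition pseudo_frobenius (S : set int) : set int :=
  [set x | ~ S x /\ forall s, max_ideal S s -> S (x + s)].

(* fset_set is empty on infinite sets, but pseudo_frobenius S is finite:
   see finite_pseudo_frobenius. *)
Definition sg_type (S : set int) : nat := #|` fset_set (pseudo_frobenius S)|.

Definition Lset (S : set int) : set int :=
  [set x | ~ S x /\ ~ S (frobenius S - x)].

Definition almost_symmetric (S : set int) : Prop :=
  Lset S `<=` pseudo_frobenius S.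

Record relative_ideal (S E : set int) : Prop := RelativeIdeal {
  rel_ideal_neq0 : E !=set0;
  rel_idealD : [set x + s | x in E & s in S] `<=` E;
  rel_ideal_sub : exists2 x, S x & [set x + y | y in E] `<=` S
}.

Definition canonical_ideal (S : set int) : set int :=
  [set x | ~ S (frobenius S - x)].

Definition ideal_diff (E F : set int) : set int :=
  [set x | forall y, F y -> E (x + y)].

Definition translate (E : set int) (z : int) : set int := [set x + z | x in E].

Definition dilate2 (X : set int) : set int := [set 2 * x | x in X].

Definition numdup (S : set int) (b : int) (E : set int) : set int :=
  dilate2 S `|` translate (dilate2 E) b.

Lemma numsg_large (S : set int) : numerical_semigroup S ->
  exists N : int, forall x : int, N <= x -> S x.
Proof.
case=> _ _ _ /finite_fsetP[F FE].
exists (\sum_(x <- F) `|x| + 1) => x lx; apply: contrapT => nSx.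
have : x \in F.
  suff : [set` F] x by [].
  rewrite -FE; split=> //=; apply: le_trans lx.
  by rewrite addr_ge0 // sumr_ge0.
move=> xF; move: lx; rewrite (big_fsetD1 x) //=.
have : 0 <= \sum_(i <- (F `\ x)%fset) `|i| by rewrite sumr_ge0.
by move: (\sum_(i <- _) _) => s; lia.
Qed.

Lemma frobeniusP (X : set int) (l N : int) :
  (forall x, x <= l -> ~ X x) -> (forall x, N <= x -> X x) ->
  ~ X (frobenius X) /\ forall x, ~ X x -> x <= frobenius X.
Proof.
move=> Xl XN.
suff [m nXm mub] : exists2 m, (~` X) m & ubound (~` X) m.
  rewrite /frobenius; case: xgetP => [y _ [nXy yub]|/(_ m) []//].
  by split=> // x nXx; apply: yub.
have ex : exists j : nat, `[< ~ X (N - j%:Z) >].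
  by exists `|N - l|%N; apply/asboolP; apply: Xl; lia.
case: (ex_minnP ex) => j /asboolP nXj jmin.
exists (N - j%:Z) => // x nXx.
have xN : x < N by rewrite ltNge; apply/negP => /XN.
have /jmin : `[< ~ X (N - (`|N - x|%N)%:Z) >].
  by apply/asboolP; have -> : N - (`|N - x|%N)%:Z = x by lia.
by lia.
Qed.

Lemma numsg_frobeniusP (S : set int) : numerical_semigroup S ->
  ~ S (frobenius S) /\ forall x, ~ S x -> x <= frobenius S.
Proof.
move=> sgS; have [N SN] := numsg_large sgS.
by apply: (@frobeniusP S (-1) N) => // x xl /(numsg_ge0 sgS) /=; lia.
Qed.

Lemma rel_ideal_frobeniusP (S E : set int) :
  numerical_semigroup S -> relative_ideal S E ->
  ~ E (frobenius E) /\ forall x, ~ E x -> x <= frobenius E.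
Proof.
move=> sgS [[e Ee] ED [s Ss sES]]; have [N SN] := numsg_large sgS.
apply: (@frobeniusP E (- s - 1) (N + e)) => x.
  move=> xs Ex; have /(numsg_ge0 sgS)/= : S (s + x) by apply: sES; exists x.
  by lia.
move=> Nx; apply: ED; exists e => //; exists (x - e); last by lia.
by apply: SN; lia.
Qed.

Lemma finite_pseudo_frobenius (S : set int) : numerical_semigroup S ->
  finite_set (pseudo_frobenius S).
Proof.
move=> sgS; have [_ Fub] := numsg_frobeniusP sgS.
have [N SN] := numsg_large sgS; pose s : int := `|N| + 1.
have sub : pseudo_frobenius S `<=`
    (fun n : nat => n%:Z - s : int) @` `I_(`|(frobenius S + s + 1)%R|%N).
  move=> x [nSx xS].
  have /(numsg_ge0 sgS)/= sx : S (x + s).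
    by apply: xS; split; [apply: SN|move=> /=]; rewrite /s; lia.
  have := Fub _ nSx; exists `|(x + s)%R|%N => /=; lia.
apply: sub_finite_set sub _; exact/finite_image/finite_II.
Qed.

Lemma numsg_numdup (S E : set int) (b : int) :
  numerical_semigroup S -> S b -> ~~ (2 %| b)%Z -> relative_ideal S E ->
  [set x + y + b | x in E & y in E] `<=` S ->
  numerical_semigroup (numdup S b E).
Proof.
move=> sgS Sb ob idE EEb; have [N SN] := numsg_large sgS.
have [_ Eub] := rel_ideal_frobeniusP sgS idE.
have SD x y : S x -> S y -> S (x + y).
  by move=> Sx Sy; apply: (numsgD sgS); exists x => //; exists y.
have ED x y : E x -> S y -> E (x + y).
  by move=> Ex Sy; apply: (rel_idealD idE); exists x => //; exists y.
have EE x y : E x -> E y -> S (x + y + b).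
  by move=> Ex Ey; apply: EEb; exists x => //; exists y.
split.
- move=> _ [[x /(numsg_ge0 sgS)/= x0 <-]|[_ [x Ex <-] <-]] /=; first lia.
  by have /(numsg_ge0 sgS)/= := EE _ _ Ex Ex; lia.
- by left; exists 0; [exact: numsg0|rewrite mulr0].
- move=> _ [_ [[x Sx <-]|[_ [x Ex <-] <-]] [_ [[y Sy <-]|[_ [y Ey <-] <-]] <-]].
  + by left; exists (x + y); [exact: SD|lia].
  + by right; exists (2 * (y + x)); [exists (y + x) => //; exact: ED|lia].
  + by right; exists (2 * (x + y)); [exists (x + y) => //; exact: ED|lia].
  + by left; exists (x + y + b); [exact: EE|lia].
- pose B : int := `|N| + `|frobenius E| + `|b| + 1.
  have sub : [set x | 0 <= x] `\` numdup S b E `<=`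
      Posz @` `I_(`|(2 * B + 2)%R|%N).
    move=> x [/= x0 nTx]; exists `|x|%N; last by lia.
    rewrite /=; apply: contrapT => /negP xB; apply: nTx.
    have [x2|x2] := boolP (2 %| x)%Z.
      left; exists (x %/ 2)%Z; last by lia.
      by apply: SN; lia.
    right; exists (2 * ((x - b) %/ 2)%Z); last by lia.
    exists ((x - b) %/ 2)%Z => //; apply: contrapT => /Eub.
    by lia.
  apply: sub_finite_set sub _; exact/finite_image/finite_II.
Qed.

(* Main.v *)
(** With F(T) = 2 F(S), membership of an integer in L(T) or PF(T) splits by
    parity: 2 y is governed by S and by E - E, while 2 y + b is governed by E,
    E - M(S) and S - E. Since K(S) is the union of S and L(S), the even part of
    L(T) `<=` PF(T) is (i) and (iii); under (iii) the odd part amounts to (ii).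
    As for the type, an almost symmetric T has PF(T) equal to L(T) together with
    F(T), and x |-> F(T) - x is an involution of L(T) whose only fixed point,
    when F(T) is even, is F(T) / 2; pairing F(T) / 2 with F(T) gives an even
    number of pseudo-Frobenius numbers. *)
Require Import Defs.
From mathcomp Require Import all_boot all_order all_algebra finmap.
From mathcomp Require Import boolp classical_sets functions cardinality.
From mathcomp Require Import zify.

Set Implicit Arguments.
Unset Strict Implicit.
Unset Printing Implicit Defensive.

Import Order.TTheory GRing.Theory Num.Theory.

Local Open Scope classical_set_scope.
Local Open Scope ring_scope.

(** * Pseudo-Frobenius numbers and the parity of the type *)

Lemma frobenius_notin (S : set int) :
  numerical_semigroup S -> ~ S (frobenius S).
Proof. by case/numsg_frobeniusP. Qed.

Lemma numsg_add (S : set int) (x y : int) :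
  numerical_semigroup S -> S x -> S y -> S (x + y).
Proof. by move=> sgS Sx Sy; apply: (numsgD sgS); exists x => //; exists y. Qed.

Lemma rel_ideal_add (S E : set int) (x s : int) :
  relative_ideal S E -> E x -> S s -> E (x + s).
Proof. by move=> idE Ex Ss; apply: (rel_idealD idE); exists x => //; exists s. Qed.

Lemma pseudo_frobenius_Lset (S : set int) (x : int) :
  pseudo_frobenius S x -> x != frobenius S -> numerical_semigroup S -> Lset S x.
Proof.
move=> [nSx xS] xF sgS; split=> // SFx; apply: (frobenius_notin sgS).
have -> : frobenius S = x + (frobenius S - x) by lia.
by apply: xS; split=> //=; lia.
Qed.

Lemma frobenius_pseudo_frobenius (S : set int) :
  numerical_semigroup S -> pseudo_frobenius S (frobenius S).
Proof.
move=> sgS; have [nSF Fub] := numsg_frobeniusP sgS.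
split=> // s [Ss /= s0]; apply: contrapT => /Fub.
by have /= := numsg_ge0 sgS Ss; lia.
Qed.

Lemma LsetC (S : set int) (x : int) : Lset S x -> Lset S (frobenius S - x).
Proof. by move=> [nSx nSFx]; split=> //; rewrite subKr. Qed.

Lemma almost_symmetric_even_type (S : set int) :
  numerical_semigroup S -> (2 %| frobenius S)%Z -> almost_symmetric S ->
  ~~ odd (sg_type S).
Proof.
move=> sgS /dvdzP[g Fg] asS; have [nSF Fub] := numsg_frobeniusP sgS.
have S0 := numsg0 sgS.
(* Evenness excludes F(S) = -1, and 0 in S excludes F(S) = 0. *)
have g_gt0 : 0 < g.
  have : - 1 <= frobenius S by apply: Fub => /(numsg_ge0 sgS).
  suff : g <> 0 by lia.
  by move=> g0; apply: nSF; rewrite Fg g0 mul0r.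
have nSg : ~ S g.
  move=> Sg; apply: nSF; have -> : frobenius S = g + g by lia.
  exact: numsg_add.
have PFg : pseudo_frobenius S g.
  by apply: asS; split=> //; have -> : frobenius S - g = g by lia.
rewrite /sg_type; set P := fset_set _.
have inP x : reflect (pseudo_frobenius S x) (x \in P).
  by rewrite in_fset_set ?inE; [exact: asboolP | exact: finite_pseudo_frobenius].
(* [low] takes the smaller element of each pair and [h] gives its partner; [g], its own mirror
   image, is paired with F(S), whose mirror image 0 is in S. *)
pose low := [fset x in P | x <= g]%fset.
pose h x := if x == g then frobenius S else frobenius S - x.
have lowP x : reflect (pseudo_frobenius S x /\ x <= g) (x \in low).
  rewrite !inE /=; apply: (iffP andP) => [[/inP]|[/inP]] //.
have h_gt x : x <= g -> g < h x by rewrite /h; case: eqP; lia.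
have PE : P = (low `|` h @` low)%fset.
  apply/fsetP => x; rewrite in_fsetU; apply/idP/orP.
    move=> /inP PFx; case: (leP x g) => xg; first by left; apply/lowP.
    right; apply/imfsetP => /=; have [->|xF] := eqVneq x (frobenius S).
      by exists g; [apply/lowP | rewrite /h eqxx].
    exists (frobenius S - x); last by rewrite /h; case: eqP; lia.
    apply/lowP; split; last by lia.
    by apply: asS; apply/LsetC; apply: pseudo_frobenius_Lset.
  move=> [/lowP[/inP]|/imfsetP[y /lowP[PFy yg] ->]] //; apply/inP.
  rewrite /h; case: eqP => _; first exact: frobenius_pseudo_frobenius.
  by apply: asS; apply/LsetC; apply: pseudo_frobenius_Lset => //; lia.
have dis : [disjoint low & h @` low]%fset.
  apply/fdisjointP => x /lowP[_ xg]; apply/imfsetP => -[y /lowP[_ /h_gt]].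
  by lia.
(* A collision between [g] and another x would mean F(S) = F(S) - x, that is x = 0, which lies in
   S. *)
have h_inj : {in low &, injective h}.
  move=> x y /lowP[[nSx _] _] /lowP[[nSy _] _].
  have x0 : x <> 0 by move=> x0; rewrite x0 in nSx.
  have y0 : y <> 0 by move=> y0; rewrite y0 in nSy.
  by rewrite /h; do 2![case: eqP]; lia.
have : #|` P| = (#|` low| + #|` (h @` low)%fset|)%N.
  by apply/eqP; rewrite {1}PE (leq_card_fsetU low (h @` low)%fset).2.
have -> : #|` (h @` low)%fset| = #|` low| by exact: card_in_imfset.
by move=> ->; rewrite addnn odd_double.
Qed.

(** * The duplication, parity by parity *)

Lemma numdup_even (S E : set int) (b x : int) :
  ~~ (2 %| b)%Z -> numdup S b E (2 * x) <-> S x.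
Proof.
move=> b_odd; split=> [[[y Sy yx]|[_ [y _ <-] yx]]|Sx]; last by left; exists x.
  by have <- : y = x by lia.
by lia.
Qed.

Lemma numdup_odd (S E : set int) (b x : int) :
  ~~ (2 %| b)%Z -> numdup S b E (2 * x + b) <-> E x.
Proof.
move=> b_odd; split=> [[[y _ yx]|[_ [y Ey <-] yx]]|Ex].
- by lia.
- by have <- : y = x by lia.
- by right; exists (2 * x) => //; exists x.
Qed.

Lemma int_parityP (b x : int) : ~~ (2 %| b)%Z ->
  (exists y, x = 2 * y) \/ (exists y, x = 2 * y + b).
Proof.
move=> b_odd; have [x2|x2] := boolP (2 %| x)%Z.
  by left; exists (x %/ 2)%Z; lia.
by right; exists ((x - b) %/ 2)%Z; lia.
Qed.

(** The largest even integer outside T is 2 F(S) and the largest odd one is 2 F(E) + b; [frobSE]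
    makes the even one win. *)
Lemma frobenius_numdup (S E : set int) (b : int) :
  numerical_semigroup S -> S b -> ~~ (2 %| b)%Z -> relative_ideal S E ->
  [set x + y + b | x in E & y in E] `<=` S ->
  2 * frobenius S > 2 * frobenius E + b ->
  frobenius (numdup S b E) = 2 * frobenius S.
Proof.
move=> sgS Sb b_odd idE EEb frobSE.
have [nTF Fub] := numsg_frobeniusP (numsg_numdup sgS Sb b_odd idE EEb).
have [nSf fub] := numsg_frobeniusP sgS.
have [_ Eub] := rel_ideal_frobeniusP sgS idE.
apply/le_anti/andP; split; last by apply: Fub => /(numdup_even _ _ _ b_odd).
have [[y Fy]|[y Fy]] := int_parityP (frobenius (numdup S b E)) b_odd.
  have /fub : ~ S y by move/(numdup_even S E y b_odd); rewrite -Fy.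
  by lia.
have /Eub : ~ E y by move/(numdup_odd S E y b_odd); rewrite -Fy.
by lia.
Qed.

Lemma Lset_numdup_even (S E : set int) (b y : int) :
  ~~ (2 %| b)%Z -> frobenius (numdup S b E) = 2 * frobenius S ->
  Lset (numdup S b E) (2 * y) <-> Lset S y.
Proof.
move=> b_odd FT; rewrite /Lset /= FT -mulrBr.
have := numdup_even S E y b_odd; have := numdup_even S E (frobenius S - y) b_odd.
by tauto.
Qed.

Lemma Lset_numdup_odd (S E : set int) (b y : int) :
  ~~ (2 %| b)%Z -> frobenius (numdup S b E) = 2 * frobenius S ->
  Lset (numdup S b E) (2 * y + b) <-> ~ E y /\ ~ E (frobenius S - b - y).
Proof.
move=> b_odd FT; rewrite /Lset /= FT.
have -> : 2 * frobenius S - (2 * y + b) = 2 * (frobenius S - b - y) + b by lia.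
have := numdup_odd S E y b_odd.
have := numdup_odd S E (frobenius S - b - y) b_odd.
by tauto.
Qed.

(** The nonzero elements of T are 2 s with s in M(S) and 2 e + b with e in E, the latter nonzero
    because b is odd. Adding the first kind to 2 y tests y + s in S, adding the second tests y + e
    in E. *)
Lemma pseudo_frobenius_numdup_even (S E : set int) (b y : int) :
  ~~ (2 %| b)%Z -> pseudo_frobenius (numdup S b E) (2 * y) <->
  pseudo_frobenius S y /\ ideal_diff E E y.
Proof.
move=> b_odd; split=> [[nTy yT]|[[nSy yS] yE]]; split.
- split=> [Sy|s [Ss /= s0]]; first by apply/nTy/numdup_even.
  apply/(numdup_even S E _ b_odd); rewrite mulrDr; apply: yT.
  by split=> /=; [apply/numdup_even | lia].
- move=> e Ee; apply/(numdup_odd S E _ b_odd); rewrite mulrDr -addrA; apply: yT.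
  by split=> /=; [apply/numdup_odd | lia].
- by move/(numdup_even S E y b_odd).
- move=> t [Tt /= t0]; have [[s ts]|[e te]] := int_parityP t b_odd.
    rewrite ts in Tt t0 *; rewrite -mulrDr; apply/numdup_even => //; apply: yS.
    by split=> /=; [apply/(numdup_even S E _ b_odd) | lia].
  rewrite te in Tt *; rewrite addrA -mulrDr; apply/numdup_odd => //; apply: yE.
  exact/(numdup_odd S E _ b_odd).
Qed.

(** Here the even elements of T test y + s in E, while two odd elements add up to the even number 2
    (y + b + e), which tests S. *)
Lemma pseudo_frobenius_numdup_odd (S E : set int) (b y : int) :
  ~~ (2 %| b)%Z -> pseudo_frobenius (numdup S b E) (2 * y + b) <->
  [/\ ~ E y, ideal_diff E (max_ideal S) y & ideal_diff S E (y + b)].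
Proof.
move=> b_odd; split=> [[nTy yT]|[nEy yM yE]]; split.
- by move=> Ey; apply/nTy/numdup_odd.
- move=> s [Ss /= s0]; apply/(numdup_odd S E _ b_odd).
  rewrite mulrDr addrAC; apply: yT.
  by split=> /=; [apply/numdup_even | lia].
- move=> e Ee; apply/(numdup_even S E _ b_odd).
  have -> : 2 * (y + b + e) = 2 * y + b + (2 * e + b) by lia.
  by apply: yT; split=> /=; [apply/numdup_odd | lia].
- by move/(numdup_odd S E y b_odd).
- move=> t [Tt /= t0]; have [[s ts]|[e te]] := int_parityP t b_odd.
    rewrite ts in Tt t0 *; rewrite addrAC -mulrDr; apply/numdup_odd => //.
    by apply: yM; split=> /=; [apply/(numdup_even S E _ b_odd) | lia].
  rewrite te in Tt *; have -> : 2 * y + b + (2 * e + b) = 2 * (y + b + e) by lia.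
  by apply/numdup_even/yE => //; apply/(numdup_odd S E _ b_odd).
Qed.

(** * Conditions (i)-(iii) and the equivalence *)

Lemma canonical_ideal_subset (S E : set int) :
  numerical_semigroup S -> relative_ideal S E ->
  canonical_ideal S `<=` ideal_diff E E <-> Lset S `<=` ideal_diff E E.
Proof.
move=> sgS idE; split=> [KE x [_ /KE]|LE x Kx] //.
have [Sx|nSx] := EM (S x); last exact: LE.
by move=> e Ee; rewrite addrC; apply: rel_ideal_add idE Ee Sx.
Qed.

(* The hypothesis on the Frobenius numbers excludes y + b + e = 0: otherwise
   F(S) + e is not in E, whence 2 e + b < 0, although 2 e + b lies in S. *)
Lemma max_ideal_diff_of_Lset_odd (S E : set int) (b y : int) :
  numerical_semigroup S -> relative_ideal S E ->
  [set x + y + b | x in E & y in E] `<=` S ->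
  2 * frobenius S > 2 * frobenius E + b ->
  canonical_ideal S `<=` ideal_diff E E ->
  ~ E (frobenius S - b - y) -> ideal_diff (max_ideal S) E (y + b).
Proof.
move=> sgS idE EEb frobSE KE nEy e Ee; split=> [|/= ye0].
  (* If y + b + e were not in S, its mirror image under F(S) would be in K(S) and so would carry e
     into E. *)
  apply: contrapT => nSe; apply: nEy.
  have -> : frobenius S - b - y = frobenius S - (y + b + e) + e by lia.
  by apply: KE Ee; rewrite /canonical_ideal /= subKr.
have [_ /(_ _ nEy)] := rel_ideal_frobeniusP sgS idE.
have /(numsg_ge0 sgS)/= : S (e + e + b) by apply: EEb; exists e => //; exists e.
by lia.
Qed.

Theorem theorem4p6 (S E : set int) (b : int)
    (sgS : numerical_semigroup S)
    (Sb : S b) (b_odd : ~~ (2 %| b)%Z)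
    (idE : relative_ideal S E)
    (EEb : [set x + y + b | x in E & y in E] `<=` S)
    (frobSE : 2 * frobenius S > 2 * frobenius E + b) :
  let T := numdup S b E in
  (almost_symmetric T <->
    [/\ almost_symmetric S,
        ideal_diff (max_ideal S) E `<=`
          translate (ideal_diff E (max_ideal S)) b
      & canonical_ideal S `<=` ideal_diff E E]) /\
  (almost_symmetric T -> ~~ odd (sg_type T)).

Proof.
move=> T; have sgT : numerical_semigroup T by apply: numsg_numdup.
have FT := frobenius_numdup sgS Sb b_odd idE EEb frobSE.
split; last by apply: almost_symmetric_even_type => //; rewrite FT dvdz_mulr.
have KLE := canonical_ideal_subset sgS idE.
split=> [asT|[asS ME /KLE LE]].
  have evenT y : Lset S y -> pseudo_frobenius S y /\ ideal_diff E E y.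
    move=> Ly; apply/(pseudo_frobenius_numdup_even S E y b_odd).
    by apply: asT; apply/Lset_numdup_even.
  split=> [y /evenT[]|z zME|] //; last by apply/KLE => y /evenT[].
  exists (z - b); last by lia.
  (* When z - b is not in E, [2 * (z - b) + b] turns out to be in L(T), hence in PF(T), whose odd
     part gives E - M(S). *)
  have [Ez|nEz] := EM (E (z - b)).
    by move=> s [Ss _]; apply: rel_ideal_add idE Ez Ss.
  (* Were F(S) - z in E, z in M(S) - E would force F(S) into S. *)
  have nEfz : ~ E (frobenius S - b - (z - b)).
    move=> /zME[Sf _]; apply: (frobenius_notin sgS).
    by have -> : frobenius S = z + (frobenius S - b - (z - b)) by lia.
  suff /(pseudo_frobenius_numdup_odd S E _ b_odd)[] :
    pseudo_frobenius T (2 * (z - b) + b) by [].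
  by apply: asT; apply/Lset_numdup_odd.
move=> x; have [[y ->]|[y ->]] := int_parityP x b_odd.
  move/(Lset_numdup_even y b_odd FT) => Ly.
  by apply/pseudo_frobenius_numdup_even => //; split; [apply: asS | apply: LE].
move/(Lset_numdup_odd y b_odd FT) => [nEy nEfy].
(* This single membership serves twice: it contains y + b in S - E, and (ii) turns it into y in E -
   M(S). *)
have yME : ideal_diff (max_ideal S) E (y + b).
  apply: max_ideal_diff_of_Lset_odd nEfy => //.
  exact/KLE.
apply/pseudo_frobenius_numdup_odd => //; split=> // [|e /yME[]//].
by have [z zEM zb] := ME _ yME; have <- : z = y by lia.
Qed.
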